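(* Let $X_{[0,T]}\in C^\infty([0,T],\mathbb R^d)$ be a smooth path, $k\ge1$, and $M\in\mathcal L(\mathbb R^d,\mathfrak{so}(k))$. For $\lambda\in\mathbb R$ let $Y^\lambda_{[0,T]}$ be the development of $X$ under $\lambda M$, i.e. the solution of $dY^\lambda_t=Y^\lambda_t(\lambda M)(\dot X_t)\,dt$, $Y^\lambda_0=I_k$, and let $Y^{\lambda,(n)}_t=\frac{\partial^n}{\partial\lambda^n}Y^\lambda_t$. Then for all $\lambda\in\mathbb R$, $n\ge1$ and $t\in[0,T]$, $$\|Y^{\lambda,(n)}_t\|_{\mathrm{HS}}\le\|M\|_{\mathrm{op}}^n\,\|X\|^n_{1\text{-var},[0,t]} .$$
   Context: $\mathfrak{so}(k)$ is the space of real antisymmetric $k\times k$ matrices; $\mathcal L(\cdot,\cdot)$ denotes linear maps. $\|\cdot\|_{\mathrm{HS}}$ is the Hilbert–Schmidt norm on matrices. $\|M\|_{\mathrm{op}}=\sup_{|x|\le1}\|M(x)\|_{\mathrm{HS}}$ with $|\cdot|$ the Euclidean norm on $\mathbb R^d$. $\|X\|_{1\text{-var},[0,t]}=\sup\sum_j|X_{t_{j+1}}-X_{t_j}|$, the supremum over all dissections of $[0,t]$. *)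

(* Defs.v *)
From mathcomp Require Import all_boot all_order all_algebra.
From mathcomp Require Import all_classical all_reals all_analysis.
Set Implicit Arguments.
Unset Strict Implicit.
Unset Printing Implicit Defensive.
Import Order.TTheory GRing.Theory Num.Theory.
Import numFieldNormedType.Exports.
Local Open Scope classical_set_scope.
Local Open Scope ring_scope.

Section norms.
Variable R : realType.

(* The library's norm on matrices and row vectors is the sup norm, which
   induces the same topology but is not the norm meant here. *)
Definition hsnorm (m n : nat) (A : 'M[R]_(m, n)) : R :=
  Num.sqrt (\sum_(i < m) \sum_(j < n) A i j ^+ 2).

Definition enorm (d : nat) (x : 'rV[R]_d) : R :=
  Num.sqrt (\sum_(j < d) x ord0 j ^+ 2).

(* M is linear on a finite-dimensional space, so this set is nonempty and
   bounded and the real supremum is genuine. *)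
Definition opnorm (d k : nat) (M : {linear 'rV[R]_d -> 'M[R]_k}) : R :=
  sup [set hsnorm (M x) | x in [set x | enorm x <= 1]].

(* Vector-valued counterpart of [variation] and [total_variation]. *)
Definition evariation (d : nat) (a b : R) (X : R -> 'rV[R]_d) (s : seq R) : R :=
  let F := X \o nth b (a :: s) in
  \sum_(0 <= i < size s) enorm (F i.+1 - F i).

Definition one_variation (d : nat) (a b : R) (X : R -> 'rV[R]_d) : \bar R :=
  ereal_sup [set (evariation a b X s)%:E | s in itv_partition a b].

End norms.

Section development.
Variables (R : realType) (V : normedModType R).

(* The derivative at t of f along A; for A = [a, b] it is the usual derivative
   inside and the one-sided derivative at a and b, and only the values of f on
   A matter. *)
Definition diffquot (f : R -> V) (t s : R) : V := (s - t)^-1 *: (f s - f t).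

Definition is_derive_within (A : set R) (f : R -> V) (t : R) (l : V) : Prop :=
  diffquot f t s @[s --> within A t^'] --> l.

Definition derive_within (A : set R) (f : R -> V) (t : R) : V :=
  lim (diffquot f t s @[s --> within A t^']).

Definition smooth_on (A : set R) (f : R -> V) : Prop :=
  forall (n : nat) (t : R), A t ->
    cvg (diffquot (iter n (derive_within A) f) t s @[s --> within A t^']).

End development.

Definition is_development (R : realType) (d k : nat) (T : R)
    (X : R -> 'rV[R]_d) (M : {linear 'rV[R]_d -> 'M[R]_k})
    (Y : R -> 'M[R]_k) : Prop :=
  Y 0 = 1%:M /\
  forall t : R, t \in `[0, T] ->
    is_derive_within `[0, T] Y t (Y t *m M (derive_within `[0, T] X t)).

(* Main.v *)
(* Fix lambda and put Q = Y^lambda, which is orthogonal. For every h the path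
   W = Y^{lambda+h} Q^T solves W' = h W B with B = Q M(X') Q^T, so that
   Y^{lambda+h} = (sum_n h^n S_n) Q, where S_0 = I and S_{n+1}' = S_n B,
   S_{n+1}(0) = 0. This power series in h has infinite radius of convergence,
   hence the n-th derivative of Y^lambda in lambda is n! S_n Q. Multiplication
   by Q preserves the Hilbert-Schmidt norm, and |S_n(t)| <= l(t)^n / n! for
   n >= 1, where l(t) is |M|_op times the length of X on [0, t]. The norm of
   S_0 = I is sqrt k, not 1, so the induction starts from S_1' = B. *)
Require Import Defs.
From mathcomp Require Import all_boot all_order all_algebra.
From mathcomp Require Import all_classical all_reals all_analysis.
From mathcomp Require Import lra ring.
Set Implicit Arguments.
Unset Strict Implicit.
Unset Printing Implicit Defensive.
Import Order.TTheory GRing.Theory Num.Theory.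
Import numFieldNormedType.Exports.
Local Open Scope classical_set_scope.
Local Open Scope ring_scope.

(** * Cauchy-Schwarz and the triangle inequality for finite families of reals *)

Section l2_norm.
Variables (R : realType) (I : finType).
Implicit Types f g : I -> R.

Definition l2 f : R := Num.sqrt (\sum_i f i ^+ 2).

Lemma sum_sqr_ge0 f : 0 <= \sum_i f i ^+ 2.
Proof. by apply: sumr_ge0 => i _; exact: sqr_ge0. Qed.

(** Lagrange's identity: twice the gap between the two sides is the double sum of the squares $(f_i
    g_j - f_j g_i)^2$. *)
Lemma cauchy_schwarz f g :
  (\sum_i f i * g i) ^+ 2 <= (\sum_i f i ^+ 2) * \sum_i g i ^+ 2.
Proof.
have H : 0 <= \sum_i \sum_j (f i * g j - f j * g i) ^+ 2.
  by apply: sumr_ge0 => i _; apply: sumr_ge0 => j _; exact: sqr_ge0.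
rewrite -subr_ge0 -(pmulr_rge0 _ (ltr0n _ 2)).
suff <- : \sum_i \sum_j (f i * g j - f j * g i) ^+ 2 =
  2 * ((\sum_i f i ^+ 2) * (\sum_i g i ^+ 2) - (\sum_i f i * g i) ^+ 2) by [].
rewrite mulrBr mulr_natl mulr2n {2}[_ * \sum_i g i ^+ 2]mulrC.
rewrite expr2 !big_distrlr /= mulr_sumr -sumrN -!big_split /=.
apply: eq_bigr => i _; rewrite mulr_sumr -sumrN -!big_split /=.
by apply: eq_bigr => j _; ring.
Qed.

Lemma l2D f g : l2 (fun i => f i + g i) <= l2 f + l2 g.
Proof.
rewrite -(ler_pXn2r (ltn0Sn 1)) ?nnegrE ?addr_ge0 ?sqrtr_ge0//.
rewrite sqrrD !sqr_sqrtr ?sum_sqr_ge0//.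
have -> : \sum_i (f i + g i) ^+ 2 =
    \sum_i f i ^+ 2 + (\sum_i f i * g i) *+ 2 + \sum_i g i ^+ 2.
  by rewrite -sumrMnl -!big_split; apply: eq_bigr => i _; rewrite sqrrD.
rewrite lerD2r lerD2l lerMn2r /= /l2 -sqrtrM ?sum_sqr_ge0//.
by apply: le_trans (ler_norm _) _; rewrite -sqrtr_sqr ler_wsqrtr// cauchy_schwarz.
Qed.

Lemma l2Z (a : R) f : l2 (fun i => a * f i) = `|a| * l2 f.
Proof.
rewrite /l2 -sqrtr_sqr -sqrtrM ?sqr_ge0// mulr_sumr.
by congr Num.sqrt; apply: eq_bigr => i _; rewrite exprMn.
Qed.

End l2_norm.

(** * The Hilbert-Schmidt norm and the operator norm *)

Section hsnorm_theory.
Variable R : realType.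

Lemma hsnorm_l2 m n (A : 'M[R]_(m, n)) :
  hsnorm A = l2 (fun p : 'I_m * 'I_n => A p.1 p.2).
Proof. by rewrite /hsnorm /l2 pair_bigA. Qed.

Lemma enormE n (x : 'rV[R]_n) : enorm x = hsnorm x.
Proof. by rewrite /enorm /hsnorm big_ord1. Qed.

Lemma hsnorm_ge0 m n (A : 'M[R]_(m, n)) : 0 <= hsnorm A.
Proof. exact: sqrtr_ge0. Qed.

Lemma hsnormD m n (A B : 'M[R]_(m, n)) : hsnorm (A + B) <= hsnorm A + hsnorm B.
Proof.
rewrite !hsnorm_l2; apply: le_trans (l2D _ _).
by rewrite /l2 ler_wsqrtr// ler_sum// => p _; rewrite mxE.
Qed.

Lemma hsnormZ m n (a : R) (A : 'M[R]_(m, n)) : hsnorm (a *: A) = `|a| * hsnorm A.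
Proof.
rewrite !hsnorm_l2 -l2Z; congr Num.sqrt.
by apply: eq_bigr => p _; rewrite mxE.
Qed.

Lemma hsnorm0 m n : hsnorm (0 : 'M[R]_(m, n)) = 0.
Proof. by rewrite -[0](scale0r 0) hsnormZ normr0 mul0r. Qed.

Lemma hsnormN m n (A : 'M[R]_(m, n)) : hsnorm (- A) = hsnorm A.
Proof. by rewrite -scaleN1r hsnormZ normrN1 mul1r. Qed.

Lemma hsnorm_sqr m n (A : 'M[R]_(m, n)) :
  hsnorm A ^+ 2 = \sum_i \sum_j A i j ^+ 2.
Proof.
by rewrite sqr_sqrtr// sumr_ge0// => i _; rewrite sumr_ge0// => j _; rewrite sqr_ge0.
Qed.

Lemma hsnorm_sqr_tr m n (A : 'M[R]_(m, n)) : hsnorm A ^+ 2 = \tr (A *m A^T).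
Proof.
rewrite hsnorm_sqr; apply: eq_bigr => i _; rewrite mxE.
by apply: eq_bigr => j _; rewrite mxE.
Qed.

Lemma ler_coord_hsnorm m n (A : 'M[R]_(m, n)) i j : `|A i j| <= hsnorm A.
Proof.
rewrite -(ler_pXn2r (ltn0Sn 1)) ?nnegrE ?hsnorm_ge0// real_normK ?num_real//.
rewrite hsnorm_sqr (bigD1 i)//= (bigD1 j)//= -addrA lerDl.
rewrite addr_ge0// sumr_ge0// => l _; first exact: sqr_ge0.
by rewrite sumr_ge0// => ? _; exact: sqr_ge0.
Qed.

Lemma hsnorm_le0 m n (A : 'M[R]_(m, n)) : hsnorm A <= 0 -> A = 0.
Proof.
move=> A0; apply/matrixP => i j; rewrite [RHS]mxE; apply/eqP; rewrite -normr_le0.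
exact: le_trans (ler_coord_hsnorm A i j) A0.
Qed.

Lemma hsnormM m n p (A : 'M[R]_(m, n)) (B : 'M[R]_(n, p)) :
  hsnorm (A *m B) <= hsnorm A * hsnorm B.
Proof.
rewrite -(ler_pXn2r (ltn0Sn 1)) ?nnegrE ?mulr_ge0 ?hsnorm_ge0//.
rewrite exprMn !hsnorm_sqr [X in _ * X]exchange_big big_distrlr /=.
apply: ler_sum => i _; apply: ler_sum => j _.
by rewrite mxE; exact: cauchy_schwarz.
Qed.

Lemma hsnorm_mulmx_orthor m n (A : 'M[R]_(m, n)) (Q : 'M[R]_n) :
  Q *m Q^T = 1%:M -> hsnorm (A *m Q) = hsnorm A.
Proof.
move=> QQ; apply/eqP; rewrite -(eqrXn2 (ltn0Sn 1)) ?hsnorm_ge0//.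
by rewrite !hsnorm_sqr_tr trmx_mul mulmxA -(mulmxA A) QQ mulmx1.
Qed.

Lemma hsnorm_tr m n (A : 'M[R]_(m, n)) : hsnorm A^T = hsnorm A.
Proof.
rewrite /hsnorm exchange_big; congr Num.sqrt.
by apply: eq_bigr => i _; apply: eq_bigr => j _; rewrite mxE.
Qed.

Lemma hsnorm_mulmx_orthol m n (Q : 'M[R]_m) (A : 'M[R]_(m, n)) :
  Q^T *m Q = 1%:M -> hsnorm (Q *m A) = hsnorm A.
Proof.
move=> QQ; rewrite -hsnorm_tr trmx_mul hsnorm_mulmx_orthor ?hsnorm_tr//.
by rewrite trmxK.
Qed.

Lemma hsnorm_sum (I : Type) (r : seq I) m n (F : I -> 'M[R]_(m, n)) :
  hsnorm (\sum_(i <- r) F i) <= \sum_(i <- r) hsnorm (F i).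
Proof.
elim/big_rec2: _ => [|i y A _ le]; first by rewrite hsnorm0.
by rewrite (le_trans (hsnormD _ _))// lerD2l.
Qed.

Section operator_norm.
Variables (d k : nat) (M : {linear 'rV[R]_d -> 'M[R]_k}).

(** A crude bound through the images of the basis vectors. It shows that the supremum in [opnorm] is
    over a bounded set, and it settles vectors of norm zero, which cannot be normalised. *)
Lemma hsnorm_linear_bound (x : 'rV[R]_d) :
  hsnorm (M x) <= (\sum_j hsnorm (M (delta_mx 0 j))) * enorm x.
Proof.
rewrite {1}[x]row_sum_delta linear_sum (le_trans (hsnorm_sum _ _))// mulr_suml.
apply: ler_sum => j _; rewrite linearZ hsnormZ mulrC.
by rewrite ler_wpM2l ?hsnorm_ge0// enormE ler_coord_hsnorm.
Qed.

Lemma opnorm_ub (x : 'rV[R]_d) : enorm x <= 1 -> hsnorm (M x) <= opnorm M.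
Proof.
move=> x1; rewrite /opnorm; apply: ub_le_sup; last by exists x.
exists (\sum_j hsnorm (M (delta_mx 0 j))) => _ [y /= y1 <-].
apply: le_trans (hsnorm_linear_bound y) _.
by rewrite ler_piMr// sumr_ge0// => j _; exact: hsnorm_ge0.
Qed.

Lemma opnorm_ge0 : 0 <= opnorm M.
Proof.
apply: le_trans (hsnorm_ge0 (M 0)) (opnorm_ub _).
by rewrite enormE hsnorm0 ler01.
Qed.

Lemma hsnorm_le_opnorm (x : 'rV[R]_d) : hsnorm (M x) <= opnorm M * enorm x.
Proof.
have [x0|x0] := eqVneq (enorm x) 0.
  by rewrite x0 mulr0 (le_trans (hsnorm_linear_bound x))// x0 mulr0.
have {}x0 : 0 < enorm x by rewrite lt_def x0 sqrtr_ge0.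
have xV : `|(enorm x)^-1| = (enorm x)^-1 by rewrite ger0_norm// invr_ge0 ltW.
rewrite -ler_pdivrMr// mulrC -xV -hsnormZ -linearZ; apply: opnorm_ub.
by rewrite enormE hsnormZ -enormE xV mulVf// gt_eqF.
Qed.

End operator_norm.

End hsnorm_theory.

(** * Calculus of derivatives relative to a set *)

Section within_derivative.
Variable R : realType.

Lemma within_dnbhs_itv_proper (a b t : R) : a < b -> t \in `[a, b] ->
  ProperFilter (within `[a, b] t^').
Proof.
move=> ab; rewrite in_itv/= => /andP[at_ tb].
apply: Build_ProperFilter => -[e /= e0 H].
have [s [ts st sab]] : exists s, [/\ `|t - s| < e, s != t & a <= s <= b].
  have [tb'|bt] := ltP t b.
  - have [bte|teb] := leP b (t + e / 2).
      by exists b; rewrite ltr_distl (gt_eqF tb') lexx (ltW ab); split => //; lra.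
    by exists (t + e / 2); rewrite ltr_distl gt_eqF; [split => //; lra|lra].
  - have [ate|tea] := leP (t - e / 2) a.
      by exists a; rewrite ltr_distl lt_eqF ?lexx ?(ltW ab); [split => //; lra|lra].
    by exists (t - e / 2); rewrite ltr_distl lt_eqF; [split => //; lra|lra].
by apply: (H s) => //=; rewrite in_itv.
Qed.

Section normed.
Variable V : normedModType R.
Implicit Types (A B : set R) (f g : R -> V) (t : R) (l m : V).

Lemma is_derive_within_subset A B f t l : B `<=` A ->
  is_derive_within A f t l -> is_derive_within B f t l.
Proof.
move=> BA; apply: cvg_trans => P; rewrite /= /nbhs/= /within/=.
by apply: filterS => s H /BA; exact: H.
Qed.

Lemma is_derive_within_cst A t (c : V) : is_derive_within A (fun=> c) t 0.
Proof.
rewrite /is_derive_within /diffquot.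
under eq_fun do rewrite subrr scaler0.
exact: cvg_cst.
Qed.

Lemma is_derive_withinD A f g t l m : is_derive_within A f t l ->
  is_derive_within A g t m -> is_derive_within A (fun s => f s + g s) t (l + m).
Proof.
move=> fl gm; rewrite /is_derive_within /diffquot.
under eq_fun do rewrite opprD addrACA scalerDr.
exact: cvgD.
Qed.

Lemma is_derive_withinZ A f t l (c : R) : is_derive_within A f t l ->
  is_derive_within A (fun s => c *: f s) t (c *: l).
Proof.
move=> fl; rewrite /is_derive_within /diffquot.
under eq_fun do rewrite -scalerBr scalerA mulrC -scalerA.
exact: cvgZl_tmp.
Qed.

Lemma is_derive_withinB A f g t l m : is_derive_within A f t l ->
  is_derive_within A g t m -> is_derive_within A (fun s => f s - g s) t (l - m).
Proof.
move=> fl gm; rewrite -[- m]scaleN1r; under eq_fun do rewrite -scaleN1r.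
exact/is_derive_withinD/is_derive_withinZ.
Qed.

Lemma is_derive_within_sum A t (n : nat) (f : nat -> R -> V) (l : nat -> V) :
  (forall i, is_derive_within A (f i) t (l i)) ->
  is_derive_within A (fun s => \sum_(i < n) f i s) t (\sum_(i < n) l i).
Proof.
move=> fl; elim: n => [|n IH].
  rewrite big_ord0; under eq_fun do rewrite big_ord0.
  exact: is_derive_within_cst.
rewrite big_ord_recr; under eq_fun do rewrite big_ord_recr.
exact: is_derive_withinD.
Qed.

Lemma near_within_dnbhs_neq A t : \forall s \near within A t^', s != t.
Proof. by rewrite near_withinE; near=> s => _; near: s; exact: nbhs_dnbhs_neq.
Unshelve. all: by end_near. Qed.

Lemma diffquotK f t s : s != t -> f t + (s - t) *: diffquot f t s = f s.
Proof.
by move=> st; rewrite /diffquot scalerA divff ?subr_eq0// scale1r addrC subrK.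
Qed.

Lemma cvg_within_dnbhs_sub A t : (s - t) @[s --> within A t^'] --> (0 : R).
Proof.
rewrite -(subrr t); apply: cvgB; last exact: cvg_cst.
by move=> P tP; apply: cvg_within; exact: nbhs_dnbhs.
Qed.

Lemma is_derive_within_cvg A f t l :
  is_derive_within A f t l -> f s @[s --> within A t^'] --> f t.
Proof.
move=> fl.
have : f t + (s - t) *: diffquot f t s @[s --> within A t^'] --> f t.
  rewrite -[X in _ --> X]addr0 -[X in _ --> _ + X](scale0r l).
  by apply: cvgD; [exact: cvg_cst|apply: cvgZ fl; exact: cvg_within_dnbhs_sub].
apply: cvg_trans; apply: near_eq_cvg; near=> s; apply: diffquotK.
by near: s; exact: near_within_dnbhs_neq.
Unshelve. all: by end_near. Qed.

End normed.

Lemma is_derive_withinM A (f g : R -> R) t l m : is_derive_within A f t l ->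
  is_derive_within A g t m ->
  is_derive_within A (fun s => f s * g s) t (l * g t + f t * m).
Proof.
move=> fl gm; rewrite /is_derive_within.
have -> : diffquot (fun s => f s * g s) t =
    fun s => diffquot f t s * g s + f t * diffquot g t s.
  have E (c x y z w : R) :
    c * (x * y - z * w) = c * (x - z) * y + z * (c * (y - w)) by ring.
  by apply/funext => s; exact: E.
apply: cvgD; last exact: cvgM (cvg_cst _) gm.
exact: cvgM fl (is_derive_within_cvg gm).
Qed.

Lemma is_derive_withinX A (f : R -> R) t l n : is_derive_within A f t l ->
  is_derive_within A (fun s => f s ^+ n.+1) t (n.+1%:R * f t ^+ n * l).
Proof.
move=> fl; elim: n => [|n IH].
  by rewrite expr0 !mul1r.
have := is_derive_withinM fl IH.
have -> : (fun s => f s * f s ^+ n.+1) = (fun s => f s ^+ n.+2).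
  by apply/funext => s; rewrite -exprS.
have E (x y : R) : y * x ^+ n.+1 + x * (n.+1%:R * x ^+ n * y) =
    n.+2%:R * x ^+ n.+1 * y by rewrite exprS -[n.+2%:R]natr1; ring.
by rewrite E.
Qed.

Section matrices.
Variables (T : Type) (F : set_system T) (FF : Filter F).

(** The topology on matrices comes from the sup norm, so limits can be taken entry by entry;
    products, transposes and [hsnorm] then reduce to real limits. *)
Lemma cvg_mxP m n (f : T -> 'M[R]_(m, n)) (L : 'M[R]_(m, n)) :
  f @ F --> L <-> forall i j, f x i j @[x --> F] --> L i j.
Proof.
split=> [fL i j|fL].
  exact: (@cvg_comp _ _ _ f (fun N : 'M[R]_(m, n) => N i j) _ _ _ fL
    (@coord_continuous _ _ _ i j L)).
apply/cvgrPdist_le => /= e e0.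
near=> x.
rewrite /Num.Def.normr/= mx_normrE (bigmax_le _ (ltW e0))//= => i _.
rewrite !mxE/=.
move: i; near: x; apply: filter_forall => /= i.
exact: ((cvgrPdist_le _ _).1 (fL i.1 i.2)).
Unshelve. all: by end_near. Qed.

Lemma cvg_sum_ord n (f : 'I_n -> T -> R) (l : 'I_n -> R) :
  (forall i, f i @ F --> l i) -> \sum_i f i x @[x --> F] --> \sum_i l i.
Proof. by move=> fl; apply: cvg_big => // -[x y]; exact: add_continuous. Qed.

Lemma cvg_mulmx m n p (f : T -> 'M[R]_(m, n)) (g : T -> 'M[R]_(n, p))
    (K : 'M[R]_(m, n)) (L : 'M[R]_(n, p)) :
  f @ F --> K -> g @ F --> L -> f x *m g x @[x --> F] --> K *m L.
Proof.
move=> /cvg_mxP fK /cvg_mxP gL; apply/cvg_mxP => i j; rewrite mxE.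
under eq_fun do rewrite mxE.
by apply: cvg_sum_ord => l; exact: cvgM.
Qed.

Lemma cvg_trmx m n (f : T -> 'M[R]_(m, n)) (L : 'M[R]_(m, n)) :
  f @ F --> L -> (f x)^T @[x --> F] --> L^T.
Proof.
move=> /cvg_mxP fL; apply/cvg_mxP => i j; rewrite mxE.
under eq_fun do rewrite mxE; exact: fL.
Qed.

Lemma cvg_hsnorm m n (f : T -> 'M[R]_(m, n)) (L : 'M[R]_(m, n)) :
  f @ F --> L -> hsnorm (f x) @[x --> F] --> hsnorm L.
Proof.
move=> /cvg_mxP fL; apply: (@cvg_comp _ _ _ _ Num.sqrt _ _ _ _ (@sqrt_continuous R _)).
apply: cvg_sum_ord => i; apply: cvg_sum_ord => j.
by rewrite expr2; under eq_fun do rewrite expr2; exact: cvgM.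
Qed.

End matrices.

Lemma is_derive_within_mulmx A m n p (f : R -> 'M[R]_(m, n))
    (g : R -> 'M[R]_(n, p)) t K L :
  is_derive_within A f t K -> is_derive_within A g t L ->
  is_derive_within A (fun s => f s *m g s) t (K *m g t + f t *m L).
Proof.
move=> fK gL; rewrite /is_derive_within.
have -> : diffquot (fun s => f s *m g s) t =
    fun s => diffquot f t s *m g s + f t *m diffquot g t s.
  apply/funext => s; rewrite /diffquot -scalemxAl -scalemxAr -scalerDr.
  by rewrite mulmxBl mulmxBr addrA subrK.
apply: cvgD; last by apply: cvg_mulmx gL; exact: cvg_cst.
by apply: cvg_mulmx fK _; exact: is_derive_within_cvg gL.
Qed.

Lemma is_derive_within_trmx A m n (f : R -> 'M[R]_(m, n)) t K :
  is_derive_within A f t K -> is_derive_within A (fun s => (f s)^T) t K^T.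
Proof.
move=> fK; rewrite /is_derive_within.
have -> : diffquot (fun s => (f s)^T) t = fun s => (diffquot f t s)^T.
  by apply/funext => s; apply/matrixP => i j; rewrite !mxE.
exact: cvg_trmx.
Qed.

End within_derivative.

(** * Real induction on an interval and the mean value inequality *)

Section interval_covering.
Variable R : realType.
Implicit Types (a b t : R).

(** Let $c$ be the supremum of the [x] with [P a x]. The local hypothesis to the left of $c$ gives
    [P a c]; to the right it would lead beyond $c$ unless $c = b$. Locally [P] is asked only for
    pairs with [t] as an endpoint, which is what a derivative at [t] controls. *)
Lemma interval_covering a b (P : R -> R -> Prop) : a <= b ->
  (forall t, t \in `[a, b] -> P t t) ->
  (forall x y z, a <= x -> x <= y -> y <= z -> z <= b ->
     P x y -> P y z -> P x z) ->
  (forall t, t \in `[a, b] -> \forall s \near within `[a, b] t^',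
     (s <= t -> P s t) /\ (t <= s -> P t s)) ->
  P a b.
Proof.
move=> ab Pxx Ptrans Ploc.
pose E := [set x | a <= x <= b /\ P a x].
have Ea : E a by split; [rewrite lexx|apply: Pxx; rewrite in_itv/= lexx].
have Eub : has_ubound E by exists b => x [/andP[]].
have ac : a <= sup E by exact: ub_le_sup.
have cb : sup E <= b by apply: ge_sup; [exists a|move=> x [/andP[]]].
have cab : sup E \in `[a, b] by rewrite in_itv/= ac.
have [e /= e0 H] := Ploc _ cab.
have {}H s : a <= s <= b -> `|sup E - s| < e ->
    (s <= sup E -> P s (sup E)) /\ (sup E <= s -> P (sup E) s).
  move=> sab se; have [->|sc] := eqVneq s (sup E); first by split=> _; exact: Pxx.
  by apply: H; rewrite //= in_itv.
have Pac : P a (sup E).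
  have [x [/andP[ax xb] Pax] xc] := sup_adherent e0 (conj (ex_intro _ a Ea) Eub).
  rewrite -/E in xc.
  have xc' : x <= sup E by apply: ub_le_sup => //; split; rewrite ?ax.
  apply: (Ptrans a x) => //; apply: (H x _ _).1 => //; first by rewrite ax.
  by rewrite ger0_norm ?subr_ge0//; lra.
have [bc|cb'] := leP b (sup E).
  by have -> : b = sup E by apply/eqP; rewrite eq_le bc cb.
have [s [cs sb se]] : exists s, [/\ sup E < s, s <= b & s - sup E < e].
  have [bce|ceb] := leP b (sup E + e / 2).
    by exists b; split => //; lra.
  by exists (sup E + e / 2); split; lra.
have sab : a <= s <= b by rewrite sb (le_trans ac)// ltW.
suff : s <= sup E by rewrite leNgt cs.
apply: ub_le_sup => //; split => //; apply: (Ptrans a (sup E)) => //.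
  exact: ltW.
by apply: (H s sab _).2; rewrite ?ltW// distrC gtr0_norm ?subr_gt0.
Qed.

(** The inequality is proved up to an arbitrarily small error proportional to the length of the
    interval. In this form it adds up over adjacent intervals and holds locally by definition of the
    derivatives. *)
Lemma mean_value_inequality m n a b (F F' : R -> 'M[R]_(m, n)) (g g' : R -> R) :
  a <= b ->
  (forall t, t \in `[a, b] -> is_derive_within `[a, b] F t (F' t)) ->
  (forall t, t \in `[a, b] -> is_derive_within `[a, b] g t (g' t)) ->
  (forall t, t \in `[a, b] -> hsnorm (F' t) <= g' t) ->
  hsnorm (F b - F a) <= g b - g a.
Proof.
rewrite le_eqVlt => /predU1P[<- _ _ _|ab dF dg F'g']; first by rewrite !subrr hsnorm0.
apply/ler_addgt0Pr => e e0.
have ba0 : 0 < b - a by rewrite subr_gt0.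
pose c := e / (b - a).
have c0 : 0 < c by rewrite divr_gt0.
have -> : e = c * (b - a) by rewrite divfK// gt_eqF.
pose P x y := hsnorm (F y - F x) <= g y - g x + c * (y - x).
apply: (@interval_covering a b P (ltW ab)) => [t _|x y z _ _ _ _ Pxy Pyz|t tab].
- by rewrite /P !subrr hsnorm0 mulr0 addr0.
- rewrite /P -(subrKA (F y)) (le_trans (hsnormD _ _))//.
  apply: le_trans (lerD Pyz Pxy) _; lra.
- have FF := within_dnbhs_itv_proper ab tab.
  have /cvgrPdist_le/(_ (c / 2)) HF := cvg_hsnorm FF (dF _ tab).
  have /cvgrPdist_le/(_ (c / 2)) Hg := dg _ tab.
  (* Each quotient is within [c / 2] of its limit, so the inequality between the derivatives passes
     to the quotients with error [c]. *)
  have {HF Hg} : \forall s \near within `[a, b] t^',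
      hsnorm (diffquot F t s) <= diffquot g t s + c.
    near=> s.
    have : `|hsnorm (F' t) - hsnorm (diffquot F t s)| <= c / 2.
      by near: s; apply: HF; lra.
    have : `|g' t - diffquot g t s| <= c / 2 by near: s; apply: Hg; lra.
    have := F'g' _ tab; rewrite !ler_distlC => ? /andP[? ?] /andP[? ?]; lra.
  apply: filterS2 (near_within_dnbhs_neq _ _) => s st Hs.
  rewrite /P -(diffquotK F st) -(diffquotK g st).
  have FE : hsnorm ((s - t) *: diffquot F t s) = `|s - t| * hsnorm (diffquot F t s).
    exact: hsnormZ.
  split=> [slet|tles].
  + rewrite opprD addNKr hsnormN FE.
    have -> : g t - (g t + (s - t) *: diffquot g t s) = (t - s) * diffquot g t s.
      by rewrite /GRing.scale/=; ring.
    by rewrite distrC ger0_norm ?subr_ge0// [c * _]mulrC -mulrDr ler_wpM2l ?subr_ge0.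
  + rewrite addrC addKr FE.
    have -> : g t + (s - t) *: diffquot g t s - g t = (s - t) * diffquot g t s.
      by rewrite /GRing.scale/=; ring.
    by rewrite ger0_norm ?subr_ge0// [c * _]mulrC -mulrDr ler_wpM2l ?subr_ge0.
Unshelve. all: by end_near. Qed.

End interval_covering.

(** * Primitives of continuous functions on a closed interval *)

Section primitive.
Variable R : realType.

Lemma is_derive1_within (A : set R) (F : R -> R) (t l : R) :
  is_derive t 1 F l -> is_derive_within A F t l.
Proof.
move=> [dF Fl]; have {dF Fl} : h^-1 *: ((F \o shift t) (h *: 1) - F t) @[h --> 0^'] --> l.
  by rewrite -Fl; exact: dF.
move/cvgrPdist_le => H; apply/cvgrPdist_le => e /H[d /= d0 {}H].
exists d => //= s ts st _; have := H (s - t).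
rewrite /= sub0r normrN distrC subr_eq0 => /(_ ts st).
by rewrite [_%:A]mulr1 subrK.
Qed.

Lemma exists_primitive (a b : R) (f : R -> R) : a < b ->
  (forall t, t \in `[a, b] -> f s @[s --> within `[a, b] t^'] --> f t) ->
  exists F : R -> R, F a = 0 /\
    forall t, t \in `[a, b] -> is_derive_within `[a, b] F t (f t).
Proof.
move=> ab fc.
(* The nearest-point projection onto [[a, b]]. Being 1-Lipschitz, it turns continuity of [f] within
   the interval into continuity of [f \o clamp] on the whole line. *)
pose clamp x := Num.max a (Num.min b x).
have clamp_itv x : clamp x \in `[a, b].
  by rewrite in_itv/= le_max lexx ge_max ge_min lexx (ltW ab).
have clamp_id x : x \in `[a, b] -> clamp x = x.
  by rewrite in_itv/= => /andP[ax xb]; rewrite /clamp min_r// max_r.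
have clamp_lip x y : `|clamp x - clamp y| <= `|x - y|.
  have := ler_norm (x - y); have := ler_norm (y - x).
  rewrite distrC ler_norml /clamp; move: `|x - y| => d yxd xyd.
  case: (leP b x); case: (leP b y) => yb xb; rewrite ?(max_r (ltW ab)).
  - lra.
  - by case: (leP a y) => ay; lra.
  - by case: (leP a x) => ax; lra.
  - by case: (leP a x) => ax; case: (leP a y) => ay; lra.
have gc : continuous (f \o clamp).
  move=> x; apply/cvgrPdist_lt => e e0.
  have /cvgrPdist_lt/(_ e e0)[d /= d0 H] := fc _ (clamp_itv x).
  exists d => //= y xy; have [->|yx] := eqVneq (clamp y) (clamp x).
    by rewrite subrr normr0.
  by apply: H => //=; exact: le_lt_trans (clamp_lip _ _) xy.
(* The lower limit [a - 1], and [b + 1] as upper end below, put [a] and [b] in the interior, where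
   the fundamental theorem gives a two-sided derivative. *)
pose G x := (\int[lebesgue_measure]_(t in [set` `[a - 1, x]]) (f \o clamp) t)%R.
exists (fun x => G x - G a); rewrite subrr; split=> // t tab.
rewrite -[X in is_derive_within _ _ _ X]subr0.
apply: is_derive_withinB; last exact: is_derive_within_cst.
apply: is_derive1_within.
have [|||dG G't] := @continuous_FTC1_closed R (f \o clamp) (a - 1) t (b + 1) _ _ _ (gc t).
- by move: tab; rewrite in_itv/=; lra.
- apply: continuous_compact_integrable; first exact: segment_compact.
  exact/continuous_subspaceT.
- by move: tab; rewrite in_itv/=; lra.
- by apply: DeriveDef; rewrite // -derive1E G't /= clamp_id.
Qed.

Lemma exists_primitive_mx m n (a b : R) (f : R -> 'M[R]_(m, n)) : a < b ->
  (forall t, t \in `[a, b] -> f s @[s --> within `[a, b] t^'] --> f t) ->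
  exists F : R -> 'M[R]_(m, n), F a = 0 /\
    forall t, t \in `[a, b] -> is_derive_within `[a, b] F t (f t).
Proof.
move=> ab fc.
have /choice[F HF] : forall p : 'I_m * 'I_n, exists F : R -> R, F a = 0 /\
    forall t, t \in `[a, b] -> is_derive_within `[a, b] F t (f t p.1 p.2).
  move=> p; apply: exists_primitive => // t tab.
  exact: (cvg_mxP _ _ _).1 (fc t tab) _ _.
exists (fun t => \matrix_(i, j) F (i, j) t); split=> [|t tab].
  by apply/matrixP => i j; rewrite !mxE (HF _).1.
apply/cvg_mxP => i j; apply: cvg_trans ((HF (i, j)).2 t tab).
by apply: near_eq_cvg; near=> s; rewrite /diffquot !mxE.
Unshelve. all: by end_near. Qed.

End primitive.

(** * Arc length and 1-variation *)

Section length.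
Variables (R : realType) (d : nat).
Implicit Type X : R -> 'rV[R]_d.

Lemma evariation_cons a b X c s :
  evariation a b X (c :: s) = enorm (X c - X a) + evariation c b X s.
Proof. by rewrite /evariation big_nat_recl. Qed.

Lemma evariation_cat a b c X s t :
  evariation a c X (s ++ t) = evariation a b X s + evariation (last a s) c X t.
Proof.
elim: s a => [|x s IH] a; first by rewrite {2}/evariation big_geq// add0r.
by rewrite cat_cons !evariation_cons IH addrA.
Qed.

(** Near [t] the increment of [l] exceeds the chord from [t] by at most [c] times the step, both
    having slope [enorm (X' t)] there. Real induction glues these one-chord partitions into a
    partition of [[a, b]] with total error [c * (b - a)]. *)
Lemma length_le_one_variation (a b : R) X (X' : R -> 'rV[R]_d) (l : R -> R) :
  a <= b ->
  (forall t, t \in `[a, b] -> is_derive_within `[a, b] X t (X' t)) ->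
  (forall t, t \in `[a, b] -> is_derive_within `[a, b] l t (enorm (X' t))) ->
  ((l b - l a)%:E <= one_variation a b X)%E.
Proof.
rewrite le_eqVlt => /predU1P[<- _ _|ab dX dl].
  rewrite subrr; apply: ereal_sup_ubound; exists [::]; first by split=> /=.
  by rewrite /evariation big_geq.
apply/lee_addgt0Pr => e e0.
have ba0 : 0 < b - a by rewrite subr_gt0.
pose c := e / (b - a).
have c0 : 0 < c by rewrite divr_gt0.
have -> : e = c * (b - a) by rewrite divfK// gt_eqF.
suff [s [sab Hs]] : exists s, itv_partition a b s /\
    l b - l a <= evariation a b X s + c * (b - a).
  apply: (@le_trans _ _ (evariation a b X s + c * (b - a))%:E).
    by rewrite lee_fin.
  by rewrite EFinD leeD2r//; apply: ereal_sup_ubound; exists s.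
pose P x y := exists s, itv_partition x y s /\
  l y - l x <= evariation x y X s + c * (y - x).
apply: (@interval_covering R a b P (ltW ab)) => [t _|x y z _ _ _ _|t tab].
- by exists [::]; split; [split => //=|rewrite /evariation big_geq//; lra].
- move=> [s [sxy Hs]] [u [uyz Hu]]; exists (s ++ u); split.
    exact: itv_partition_cat sxy uyz.
  rewrite (evariation_cat _ y); have [_ /eqP ->] := sxy; lra.
- have FF := within_dnbhs_itv_proper ab tab.
  have /cvgrPdist_le/(_ (c / 2)) HX := cvg_hsnorm FF (dX _ tab).
  have /cvgrPdist_le/(_ (c / 2)) Hl := dl _ tab.
  have {HX Hl} : \forall s \near within `[a, b] t^',
      diffquot l t s <= hsnorm (diffquot X t s) + c.
    near=> s.
    have : `|hsnorm (X' t) - hsnorm (diffquot X t s)| <= c / 2.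
      by near: s; apply: HX; lra.
    have : `|enorm (X' t) - diffquot l t s| <= c / 2 by near: s; apply: Hl; lra.
    rewrite enormE !ler_distlC => /andP[? ?] /andP[? ?]; lra.
  apply: filterS2 (near_within_dnbhs_neq _ _) => s st Hs.
  have XE := hsnormZ (s - t) (diffquot X t s).
  have lE : (s - t) * diffquot l t s = l s - l t.
    by rewrite /diffquot /GRing.scale/= mulrA divff ?mul1r// subr_eq0.
  have {}XE : `|s - t| * hsnorm (diffquot X t s) = enorm (X s - X t).
    by rewrite -hsnormZ enormE /diffquot scalerA divff ?subr_eq0// scale1r.
  have {}Hs := ler_wpM2l (normr_ge0 (s - t)) Hs.
  split=> [slet|tles].
  + exists [:: t]; split.
      by apply: itv_partition1; rewrite lt_neqAle st.
    rewrite evariation_cons /evariation big_geq// addr0 enormE -hsnormN opprB -enormE.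
    by move: Hs; rewrite mulrDr XE distrC ger0_norm ?subr_ge0//; lra.
  + exists [:: s]; split.
      by apply: itv_partition1; rewrite lt_neqAle eq_sym st.
    rewrite evariation_cons /evariation big_geq// addr0.
    by move: Hs; rewrite mulrDr XE ger0_norm ?subr_ge0//; lra.
Unshelve. all: by end_near. Qed.

End length.

(** * Everywhere convergent power series and their iterated derivatives *)

Section entire_series.
Variable R : realType.

Lemma series_shift (u : R^nat) : cvgn (series u) -> cvgn (series (fun i => u i.+1)).
Proof.
move=> cu; have -> : series (fun i => u i.+1) = fun n => series u n.+1 - u 0.
  by apply/funext => n; rewrite /series/= big_nat_recl// addrC addKr.
apply/cvg_ex; exists (limn (series u) - u 0); apply: cvgB; last exact: cvg_cst.
by rewrite (cvg_shiftS (series u)).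
Qed.

Lemma is_cvg_pseries_diffs (c : R^nat) : (forall z, cvgn (pseries c z)) ->
  forall z, cvgn (pseries (pseries_diffs c) z).
Proof.
move=> cc z; apply: normed_cvg.
(* With this [K], $(i+1)|z|^i \le 2^{i+1}(|z|+1)^{i+1} = K^{i+1}$. The differentiated series at [z]
   is thus dominated by a shift of the original one at [K], which converges absolutely because of
   convergence at [K + 1]. *)
pose K := 2 * (`|z| + 1).
have K0 : 0 <= K by rewrite mulr_ge0// addr_ge0.
have := is_cvg_pseries_inside_norm (cc (K + 1)) (z := K).
rewrite !ger0_norm ?addr_ge0// ltrDl ltr01 => /(_ isT)/series_shift.
apply: series_le_cvg => i /=.
- exact: normr_ge0.
- by rewrite mulr_ge0// exprn_ge0.
- rewrite /pseries_diffs !normrM normrX normr_nat -mulrA mulrCA ler_wpM2l//.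
  rewrite exprMn ler_pM// ?exprn_ge0//.
    by rewrite -natrX ler_nat ltnW// ltn_expl.
  apply: (@le_trans _ _ ((`|z| + 1) ^+ i)).
    by rewrite lerXn2r ?nnegrE ?addr_ge0// lerDl.
  by rewrite exprS ler_peMl ?exprn_ge0 ?lerDr// ?addr_ge0.
Qed.

Lemma iter_pseries_diffs (c : R^nat) n i :
  i`!%:R * iter n (@pseries_diffs R) c i = (n + i)`!%:R * c (n + i)%N.
Proof.
elim: n i => [//|n IH] i.
rewrite iterS {1}/pseries_diffs mulrA -natrM mulnC -factS IH.
by rewrite addnS addSn.
Qed.

(** Termwise differentiation. The second conclusion has the form of the hypothesis, with [c]
    replaced by its formal derivative, so the lemma can be iterated. *)
Lemma entire_series_derive (c : R^nat) (x0 : R) (f : R -> R) :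
  (forall y, pseries c (y - x0) n @[n --> \oo] --> f y) ->
  (forall y, derivable f y 1) /\
  (forall y, pseries (pseries_diffs c) (y - x0) n @[n --> \oo] --> derive1 f y).
Proof.
move=> cf.
have cc z : cvgn (pseries c z).
  by apply/cvg_ex; exists (f (z + x0)); have := cf (z + x0); rewrite addrK.
have cc1 := is_cvg_pseries_diffs cc.
have cc2 := is_cvg_pseries_diffs cc1.
have fE : f = (fun z => limn (pseries c z)) \o (fun y => y - x0).
  by apply/funext => y; apply/esym/cvg_lim.
have df (y : R) : is_derive y 1 f (limn (pseries (pseries_diffs c) (y - x0))).
  rewrite fE -[X in is_derive _ _ _ X]mulr1; apply: is_derive1_comp; last first.
    by rewrite -[X in is_derive _ _ _ X]subr0; exact: is_deriveB.
  apply: (@pseries_snd_diffs _ c (`|y - x0| + 1)) => //.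
  by rewrite [X in _ < X]ger0_norm ?addr_ge0// ltrDl.
split=> z; first by have [] := df z.
by rewrite derive1E; have [_ ->] := df z; exact: cc1.
Qed.

(** At the centre [x0] only the constant term of the [n] times differentiated series survives, and
    its coefficient is $n!\,c_n$. *)
Lemma entire_series_derive1n (c : R^nat) (x0 : R) (f : R -> R) :
  (forall y, pseries c (y - x0) n @[n --> \oo] --> f y) ->
  forall n, (forall y, derivable (derive1n n f) y 1) /\
    derive1n n f x0 = n`!%:R * c n.
Proof.
move=> cf.
have H n y : pseries (iter n (@pseries_diffs R) c) (y - x0) m @[m --> \oo]
    --> derive1n n f y.
  elim: n y => [//|n IH] y; rewrite derive1nS.
  exact: (entire_series_derive IH).2.
move=> n; split; first exact: (entire_series_derive (H n)).1.
have := iter_pseries_diffs c n 0; rewrite addn0 mul1r => <-.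
have /cvg_lim <- // := H n x0.
apply/cvg_lim => //; rewrite subrr -cvg_shiftS/=; apply: cvg_near_cst.
near=> m; rewrite /pseries/series/= big_nat_recl// expr0 mulr1 big1 ?addr0//.
by move=> i _; rewrite exprS mul0r mulr0.
Unshelve. all: by end_near. Qed.

(** Differentiation acts entrywise where the matrix function is derivable, so the formula at each
    order first yields derivability and only then the formula at the next order. *)
Lemma derive1n_mx k l (f : R -> 'M[R]_(k, l)) :
  (forall i j n x, derivable (derive1n n (fun y => f y i j)) x 1) ->
  forall n x, derivable (derive1n n f) x 1 /\
    derive1n n f x = \matrix_(i, j) derive1n n (fun y => f y i j) x.
Proof.
move=> df.
have dmx n : derive1n n f = (fun x => \matrix_(i, j) derive1n n (fun y => f y i j) x) ->
    forall x, derivable (derive1n n f) x 1.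
  move=> -> x; apply/derivable_mxP => i j.
  by under eq_fun do rewrite mxE; exact: df.
have fE n : derive1n n f = (fun x => \matrix_(i, j) derive1n n (fun y => f y i j) x).
  elim: n => [|n IH]; apply/funext => x; apply/matrixP => i j; first by rewrite mxE.
  rewrite derive1nS derive1E derive_mx; last exact: dmx.
  by rewrite !mxE derive1nS derive1E IH; under eq_fun do rewrite mxE.
by move=> n x; split; [exact: dmx|rewrite fE].
Qed.

End entire_series.

(** * Continuity of linear maps, and estimates over the initial intervals of $[0,T]$ *)

Lemma cvg_linear_rV (R : realType) d k (M : {linear 'rV[R]_d -> 'M[R]_k})
    (S : Type) (F : set_system S) (FF : Filter F) (f : S -> 'rV[R]_d) (x : 'rV[R]_d) :
  f @ F --> x -> M (f s) @[s --> F] --> M x.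
Proof.
move=> /(cvg_mxP FF) fx; apply/(cvg_mxP FF) => i j.
have ME (y : 'rV[R]_d) : M y i j = \sum_l y 0 l * M (delta_mx 0 l) i j.
  rewrite {1}[y]row_sum_delta linear_sum summxE.
  by apply: eq_bigr => l _; rewrite linearZ mxE.
rewrite ME; under eq_fun do rewrite ME.
by apply: cvg_sum_ord => l; apply: cvgM; [exact: fx|exact: cvg_cst].
Qed.

Section interval.
Variables (R : realType) (T : R).

Let subset_0t t : t \in `[0, T] -> `[0, t]%classic `<=` `[0, T].
Proof.
rewrite in_itv/= => /andP[_ tT] s /=; rewrite !in_itv/= => /andP[-> st].
exact: le_trans st tT.
Qed.

Lemma mean_value_inequality_0t m n (F F' : R -> 'M[R]_(m, n)) (g g' : R -> R) :
  (forall t, t \in `[0, T] -> is_derive_within `[0, T] F t (F' t)) ->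
  (forall t, t \in `[0, T] -> is_derive_within `[0, T] g t (g' t)) ->
  (forall t, t \in `[0, T] -> hsnorm (F' t) <= g' t) ->
  forall t, t \in `[0, T] -> hsnorm (F t - F 0) <= g t - g 0.
Proof.
move=> dF dg F'g' t tT.
apply: (@mean_value_inequality R m n 0 t F F' g g') => [|s st|s st|s st].
- by move: tT; rewrite in_itv/= => /andP[].
- by apply: is_derive_within_subset (dF s (subset_0t tT st)); exact: subset_0t.
- by apply: is_derive_within_subset (dg s (subset_0t tT st)); exact: subset_0t.
- exact: F'g' (subset_0t tT st).
Qed.

Lemma length_le_one_variation_0t d (X X' : R -> 'rV[R]_d) (l : R -> R) :
  (forall t, t \in `[0, T] -> is_derive_within `[0, T] X t (X' t)) ->
  (forall t, t \in `[0, T] -> is_derive_within `[0, T] l t (enorm (X' t))) ->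
  forall t, t \in `[0, T] -> ((l t - l 0)%:E <= one_variation 0 t X)%E.
Proof.
move=> dX dl t tT; apply: (@length_le_one_variation R d 0 t X X') => [|s st|s st].
- by move: tT; rewrite in_itv/= => /andP[].
- by apply: is_derive_within_subset (dX s (subset_0t tT st)); exact: subset_0t.
- by apply: is_derive_within_subset (dl s (subset_0t tT st)); exact: subset_0t.
Qed.

(** Skewness of [A] makes the derivative $Q(A + A^T)Q^T$ of $QQ^T$ vanish, and the mean value
    inequality with bound 0 keeps $QQ^T$ at its initial value. *)
Lemma orthogonal_solution k (Q A : R -> 'M[R]_k) : Q 0 = 1%:M ->
  (forall t, t \in `[0, T] -> is_derive_within `[0, T] Q t (Q t *m A t)) ->
  (forall t, (A t)^T = - A t) ->
  forall t, t \in `[0, T] -> Q t *m (Q t)^T = 1%:M.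
Proof.
move=> Q0 dQ skA t tT.
have dQQ s : s \in `[0, T] ->
    is_derive_within `[0, T] (fun s => Q s *m (Q s)^T) s (0 : 'M[R]_k).
  move=> sT; have := is_derive_within_mulmx (dQ s sT) (is_derive_within_trmx (dQ s sT)).
  by rewrite trmx_mul skA mulNmx mulmxN mulmxA subrr.
have := mean_value_inequality_0t dQQ
  (fun s _ => is_derive_within_cst `[0, T] s (0 : R)) _ tT.
rewrite subrr hsnorm0 => /(_ (fun _ _ => lexx _)) H.
by apply/subr0_eq/hsnorm_le0; move: H; rewrite Q0 trmx1 mulmx1.
Qed.

(** One integration step of the factorial bounds, from $(L^{n+1}/(n+1)!)' = b\,L^n/n!$. It serves
    both the iterated integrals and the Taylor remainder, with different constants [c]. *)
Lemma hsnorm_primitive_le k (F F' : R -> 'M[R]_k) (L b : R -> R) (c : R) n :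
  F 0 = 0 -> L 0 = 0 ->
  (forall t, t \in `[0, T] -> is_derive_within `[0, T] F t (F' t)) ->
  (forall t, t \in `[0, T] -> is_derive_within `[0, T] L t (b t)) ->
  (forall t, t \in `[0, T] -> hsnorm (F' t) <= c * (L t ^+ n / n`!%:R) * b t) ->
  forall t, t \in `[0, T] -> hsnorm (F t) <= c * (L t ^+ n.+1 / n.+1`!%:R).
Proof.
move=> F0 L0 dF dL F'b t tT.
pose g t := c / n.+1`!%:R * L t ^+ n.+1.
pose g' t := c / n.+1`!%:R * (n.+1%:R * L t ^+ n * b t).
have dg s : s \in `[0, T] -> is_derive_within `[0, T] g s (g' s).
  move=> sT; have := is_derive_withinX (n := n) (dL s sT).
  by move/(is_derive_withinZ (c := c / n.+1`!%:R)).
have F'g' s : s \in `[0, T] -> hsnorm (F' s) <= g' s.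
  move=> sT; rewrite (le_trans (F'b s sT))// le_eqVlt; apply/orP; left.
  rewrite /g' factS natrM; apply/eqP; field.
  by rewrite pnatr_eq0 -lt0n fact_gt0 addrC natr1 pnatr_eq0.
have := mean_value_inequality_0t dF dg F'g' tT.
by rewrite F0 subr0 /g L0 expr0n mulr0 subr0 -!mulrA [_^-1 * _]mulrC.
Qed.

End interval.

(** * Taylor expansion of the development in the parameter *)

Section taylor_expansion.
Variables (R : realType) (T : R) (k : nat) (A : R -> 'M[R]_k) (Y : R -> R -> 'M[R]_k).
(** [A] stands for $M(\dot X)$, [b] for a pointwise bound of its norm and [L] for the primitive of
    [b]; in the application [b] is the operator norm times the speed. *)
Variables (L b : R -> R).
Hypothesis T0 : 0 < T.
Hypothesis skA : forall t, (A t)^T = - A t.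
Hypothesis cA : forall t, t \in `[0, T] -> A s @[s --> within `[0, T] t^'] --> A t.
Hypothesis Y0 : forall lambda, Y lambda 0 = 1%:M.
Hypothesis dY : forall lambda t, t \in `[0, T] ->
  is_derive_within `[0, T] (Y lambda) t (Y lambda t *m (lambda *: A t)).
Hypothesis L0 : L 0 = 0.
Hypothesis dL : forall t, t \in `[0, T] -> is_derive_within `[0, T] L t (b t).
Hypothesis Ab : forall t, t \in `[0, T] -> hsnorm (A t) <= b t.

Lemma development_orthogonal lambda t : t \in `[0, T] ->
  Y lambda t *m (Y lambda t)^T = 1%:M.
Proof.
move=> tT.
apply: (orthogonal_solution (A := fun s => lambda *: A s)
  (Y0 lambda) (@dY lambda) _ tT) => s.
by rewrite linearZ/= skA scalerN.
Qed.

Lemma driver_ge0 t : t \in `[0, T] -> 0 <= b t.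
Proof. by move=> /Ab; apply: le_trans; exact: hsnorm_ge0. Qed.

Lemma control_ge0 t : t \in `[0, T] -> 0 <= L t.
Proof.
move=> tT; have -> : L t = L t - L 0 by rewrite L0 subr0.
have d0 s : s \in `[0, T] -> is_derive_within `[0, T] (fun=> 0 : 'M[R]_k) s 0.
  by move=> _; exact: is_derive_within_cst.
have H := mean_value_inequality_0t d0 dL _ tT.
apply: (le_trans (hsnorm_ge0 _) (H _)) => s sT.
by rewrite hsnorm0; exact: driver_ge0.
Qed.

Section at_lambda.
Variable lambda : R.

Let Q := Y lambda.
Let B t := Q t *m A t *m (Q t)^T.

Let QQt t : t \in `[0, T] -> Q t *m (Q t)^T = 1%:M.
Proof. exact: development_orthogonal. Qed.

Let QtQ t : t \in `[0, T] -> (Q t)^T *m Q t = 1%:M.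
Proof. by move=> tT; apply: mulmx1C; exact: QQt. Qed.

Let cB t : t \in `[0, T] -> B s @[s --> within `[0, T] t^'] --> B t.
Proof.
move=> tT; have cQ := is_derive_within_cvg (@dY lambda _ tT).
by apply: cvg_mulmx; [apply: cvg_mulmx cQ (cA tT)|exact: cvg_trmx].
Qed.

Let Bb t : t \in `[0, T] -> hsnorm (B t) <= b t.
Proof.
move=> tT; rewrite /B hsnorm_mulmx_orthor ?trmxK ?QtQ//.
by rewrite hsnorm_mulmx_orthol ?QtQ// Ab.
Qed.

(* The iterated integrals S n.+1 = \int S n B of the conjugated driver
   B = Q A Q^T are the Taylor coefficients at lambda, up to the factor Q. *)
Lemma exists_iterated_integrals : exists S : nat -> R -> 'M[R]_k,
  [/\ S 0 = (fun=> 1%:M), forall n, S n.+1 0 = 0 &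
    forall n t, t \in `[0, T] -> is_derive_within `[0, T] (S n.+1) t (S n t *m B t)].
Proof.
pose C (G : R -> 'M[R]_k) :=
  forall t, t \in `[0, T] -> G s @[s --> within `[0, T] t^'] --> G t.
(* Continuity of [G] is a premise inside the chosen property, so that [next] is a total operator and
   can be iterated; for a discontinuous [G] any witness will do. *)
have /choice[next nextP] : forall G, exists F, C G -> F 0 = 0 /\
    forall t, t \in `[0, T] -> is_derive_within `[0, T] F t (G t *m B t).
  move=> G; have [cG|ncG] := pselect (C G); last by exists G.
  have [|F FP] := @exists_primitive_mx R k k 0 T (fun t => G t *m B t) T0.
    by move=> t tT; exact: cvg_mulmx (cG t tT) (cB tT).
  by exists F.
pose S n := iter n next (fun=> 1%:M).
have cS n : C (S n).
  elim: n => [|n IH] t tT; first exact: cvg_cst.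
  exact: is_derive_within_cvg ((nextP _ IH).2 t tT).
by exists S; split=> // n; have [] := nextP _ (cS n).
Qed.

Variable S : nat -> R -> 'M[R]_k.
Hypothesis S0 : S 0 = (fun=> 1%:M).
Hypothesis Sn0 : forall n, S n.+1 0 = 0.
Hypothesis dS : forall n t, t \in `[0, T] ->
  is_derive_within `[0, T] (S n.+1) t (S n t *m B t).

Lemma hsnorm_iterated_integral n t : (0 < n)%N -> t \in `[0, T] ->
  hsnorm (S n t) <= L t ^+ n / n`!%:R.
Proof.
case: n => // n _; elim: n t => [|n IH] t tT; rewrite -[leRHS]mul1r;
  apply: (hsnorm_primitive_le (Sn0 _) L0 (@dS _) dL _ tT) => s sT.
(* The identity [S 0] is removed before norms are taken; bounding it by its norm would cost a factor
   $\sqrt k$. *)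
- by rewrite S0 mul1mx expr0 fact0 divr1 !mul1r Bb.
- rewrite mul1r (le_trans (hsnormM _ _))// ler_pM ?hsnorm_ge0//.
    exact: IH.
  exact: Bb.
Qed.

Section remainder.
Variable h : R.

Let W t := Y (lambda + h) t *m (Q t)^T.
Let remainder n t := W t - \sum_(i < n) h ^+ i *: S i t.

(** By skewness the factor $Q^T$ contributes its [lambda] term with a minus sign, which cancels the
    [lambda] part coming from [Y (lambda + h)]; only [h] remains. *)
Let dW t : t \in `[0, T] -> is_derive_within `[0, T] W t (h *: (W t *m B t)).
Proof.
move=> tT.
have := is_derive_within_mulmx (@dY (lambda + h) _ tT)
  (is_derive_within_trmx (@dY lambda _ tT)).
congr (is_derive_within _ _ _ _).
rewrite trmx_mul [(_ *: _)^T]linearZ/= skA -!scalemxAr -!scalemxAl -scalemxAr.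
rewrite mulNmx mulmxN scalerN.
rewrite !mulmxA -(mulmxA _ (_^T)) (QtQ tT) mulmx1 -scalerBl.
by rewrite addrC addKr.
Qed.

(** The term of index 0 is constant, and each later one differentiates to [h] times its predecessor
    times [B]; hence the truncation order drops by one. *)
Let dremainder n t : t \in `[0, T] ->
  is_derive_within `[0, T] (remainder n.+1) t (h *: (remainder n t *m B t)).
Proof.
move=> tT.
pose S' i := if i is j.+1 then S j t *m B t else 0.
have dS' i : is_derive_within `[0, T] (fun s => h ^+ i *: S i s) t (h ^+ i *: S' i).
  apply: is_derive_withinZ; case: i => [|i]; last exact: dS.
  by rewrite S0; exact: is_derive_within_cst.
have := is_derive_withinB (dW tT) (is_derive_within_sum (n := n.+1) dS').
congr (is_derive_within _ _ _ _).
rewrite big_ord_recl/= scaler0 add0r mulmxBl scalerBr; congr (_ - _).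
rewrite mulmx_suml scaler_sumr; apply: eq_bigr => i _.
by rewrite exprS -scalemxAl scalerA.
Qed.

(** At order 0 the remainder is [W], a product of orthogonal matrices, with the norm of the
    identity. Each further order integrates the previous bound, starting from 0 because $S_0 = I$
    removes $W(0) = I$. *)
Lemma hsnorm_remainder n t : t \in `[0, T] ->
  hsnorm (remainder n t) <= hsnorm (1%:M : 'M[R]_k) * `|h| ^+ n * (L t ^+ n / n`!%:R).
Proof.
elim: n t => [|n IH] t tT.
  rewrite /remainder big_ord0 subr0 !expr0 fact0 divr1 !mulr1.
  rewrite hsnorm_mulmx_orthor ?trmxK ?QtQ//.
  by rewrite -[Y _ _]mul1mx hsnorm_mulmx_orthor// development_orthogonal.
apply: (hsnorm_primitive_le _ L0 (@dremainder n) dL _ tT).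
  rewrite /remainder big_ord_recl big1; last by move=> i _; rewrite Sn0 scaler0.
  by rewrite /W /Q !Y0 S0 trmx1 mulmx1 expr0 scale1r addr0 subrr.
move=> s sT; rewrite hsnormZ.
have E (x y z u v : R) : x * (y * z) * u * v = y * (x * z * u * v) by ring.
rewrite exprS E ler_wpM2l// (le_trans (hsnormM _ _))// ler_pM ?hsnorm_ge0 ?Bb//.
exact: IH.
Qed.

Lemma remainder_development m t : t \in `[0, T] ->
  Y (lambda + h) t - \sum_(n < m) h ^+ n *: (S n t *m Q t) = remainder m t *m Q t.
Proof.
move=> tT; rewrite mulmxBl -mulmxA (QtQ tT) mulmx1 mulmx_suml.
by congr (_ - _); apply: eq_bigr => n _; rewrite scalemxAl.
Qed.

(** The remainder bound is a constant times the general term of the exponential series at $|h|L(t)$,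
    hence tends to 0. *)
Lemma cvg_pseries_development t i j : t \in `[0, T] ->
  pseries (fun n => (S n t *m Q t) i j) h m @[m --> \oo] --> Y (lambda + h) t i j.
Proof.
move=> tT.
have cvg0 : hsnorm (1%:M : 'M[R]_k) * exp_coeff (`|h| * L t) m @[m --> \oo] --> (0 : R).
  rewrite -[X in _ --> X](mulr0 (hsnorm (1%:M : 'M[R]_k))).
  by apply: cvgM; [exact: cvg_cst|exact/cvg_series_cvg_0/is_cvg_series_exp_coeff].
apply/cvgrPdist_le => e e0.
near=> m.
have -> : pseries (fun n => (S n t *m Q t) i j) h m =
    (\sum_(n < m) h ^+ n *: (S n t *m Q t)) i j.
  rewrite /pseries/series/= big_mkord summxE.
  by apply: eq_bigr => n _; rewrite [in RHS]mxE mulrC.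
have -> : Y (lambda + h) t i j - (\sum_(n < m) h ^+ n *: (S n t *m Q t)) i j =
    (remainder m t *m Q t) i j.
  by rewrite -remainder_development// !mxE.
apply: le_trans (ler_coord_hsnorm _ i j) _.
rewrite hsnorm_mulmx_orthor ?QQt//.
apply: le_trans (hsnorm_remainder m tT) _.
rewrite -mulrA (mulrA (`|h| ^+ m)) -exprMn.
have : `|0 - hsnorm (1%:M : 'M[R]_k) * exp_coeff (`|h| * L t) m| <= e.
  by near: m; exact: (cvgrPdist_le _ _).1 cvg0 e e0.
by rewrite sub0r normrN; apply: le_trans; exact: ler_norm.
Unshelve. all: by end_near. Qed.

End remainder.
End at_lambda.

(** The [n]-th derivative is $n!\,S_n Q$: the factor $n!$ cancels the denominator in the bound of
    $S_n$, and the orthogonal $Q$ preserves the norm. *)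
Lemma derive1n_development lambda t n : t \in `[0, T] ->
  (forall m, derivable (derive1n m (fun l => Y l t)) lambda 1) /\
  ((0 < n)%N -> hsnorm (derive1n n (fun l => Y l t) lambda) <= L t ^+ n).
Proof.
move=> tT.
have [S [S0 Sn0 dS]] := exists_iterated_integrals lambda.
have H i j := @entire_series_derive1n R (fun n => (S n t *m Y lambda t) i j) lambda
  (fun l => Y l t i j).
have {}H i j n' : (forall y, derivable (derive1n n' (fun l => Y l t i j)) y 1) /\
    derive1n n' (fun l => Y l t i j) lambda = n'`!%:R * (S n' t *m Y lambda t) i j.
  apply: H => y; rewrite -[in X in _ --> X](subrK lambda y) [y - lambda + _]addrC.
  exact: cvg_pseries_development.
have D := derive1n_mx (fun i j n' => (H i j n').1).
split=> [m|n0]; first exact: (D m lambda).1.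
rewrite (D n lambda).2.
have -> : \matrix_(i, j) derive1n n (fun y => Y y t i j) lambda =
    n`!%:R *: (S n t *m Y lambda t).
  by apply/matrixP => i j; rewrite [LHS]mxE [RHS]mxE (H i j n).2.
rewrite hsnormZ normr_nat hsnorm_mulmx_orthor ?development_orthogonal//.
rewrite mulrC -ler_pdivlMr ?ltr0n ?fact_gt0//.
exact: (hsnorm_iterated_integral S0 Sn0 dS).
Qed.

End taylor_expansion.

(** * Specialisation to the driver $M(\dot X)$, controlled by the arc length *)

Theorem corollary3p2 (R : realType) (d k : nat) (T : R)
    (X : R -> 'rV[R]_d) (M : {linear 'rV[R]_d -> 'M[R]_k})
    (Y : R -> R -> 'M[R]_k) :
  0 < T -> smooth_on `[0, T] X ->
  (1 <= k)%N -> (forall x : 'rV[R]_d, M x \is skewmx) ->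
  (forall lambda : R, is_development T X (lambda \*: M) (Y lambda)) ->
  forall (lambda : R) (n : nat) (t : R), (1 <= n)%N -> t \in `[0, T] ->
    (forall m : nat, (m < n)%N ->
       derivable (derive1n m (fun l : R => Y l t)) lambda 1) /\
    ((hsnorm (derive1n n (fun l : R => Y l t) lambda))%:E
       <= (opnorm M)%:E ^+ n * one_variation 0 t X ^+ n)%E.
Proof.
move=> T0 smX _ skM devY lambda n t n0 tT.
pose X' := derive_within `[0, T] X.
have dX s : s \in `[0, T] -> is_derive_within `[0, T] X s (X' s).
  by move=> sT; exact: (smX 0 s sT).
(* Smoothness at order 1 makes [X'] differentiable within the interval, hence continuous there, so
   that the speed has a primitive. *)
have cX' s : s \in `[0, T] -> X' u @[u --> within `[0, T] s^'] --> X' s.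
  by move=> sT; exact: (@is_derive_within_cvg _ _ _ _ _
    (derive_within `[0, T] X' s) (smX 1 s sT)).
have [|l [l0 dl]] := @exists_primitive R 0 T (fun s => enorm (X' s)) T0.
  move=> s sT; rewrite enormE; under eq_fun do rewrite enormE.
  exact: cvg_hsnorm (cX' s sT).
have [|||||||dY Yle] := @derive1n_development R T k (M \o X') Y
  (fun s => opnorm M * l s) (fun s => opnorm M * enorm (X' s)) T0 _ _ _ _ _ _ _
  lambda t n tT.
(* Membership in [skewmx] is the hermitian condition with sign $-1$ and the identity as
   involution. *)
- move=> s /=; rewrite {2}(is_hermitianmxP _ _ _ (skM (X' s))).
  by rewrite expr1 scaleN1r opprK map_mx_id.
- by move=> s sT; exact: cvg_linear_rV (cX' s sT).
- by move=> l'; have [] := devY l'.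
- by move=> l' s sT; have [_] := devY l'; exact.
- by rewrite l0 mulr0.
- by move=> s sT; exact: is_derive_withinZ (dl s sT).
- by move=> s sT; exact: hsnorm_le_opnorm.
split=> [m _|]; first exact: dY.
have lV := length_le_one_variation_0t dX dl tT.
rewrite l0 subr0 in lV.
have lt0 : 0 <= l t.
  (* The zero driver of size 1 is bounded by the speed, which gives the nonnegativity of the
     length. *)
  have := @control_ge0 R T 1 (fun=> 0) l (fun s => enorm (X' s)) l0 dl.
  by apply=> // s sT; rewrite hsnorm0 sqrtr_ge0.
apply: (@le_trans _ _ ((opnorm M * l t) ^+ n)%:E); first by rewrite lee_fin Yle.
rewrite exprMn EFinM !EFin_expe lee_wpmul2l ?expe_ge0 ?lee_fin ?opnorm_ge0//.
(* The variation is an extended real, so the powers are compared by induction on the exponent. *)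
elim: (n) => [|m IH]; first by rewrite !expe0.
by rewrite !expeS lee_pmul// ?expe_ge0 ?lee_fin.
Qed.
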